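(* Let $p=b_1\otimes b_2\otimes\cdots\otimes b_L\in B^{r_1,s_1}\otimes B^{r_2,s_2}\otimes\cdots\otimes B^{r_L,s_L}$, and denote by $N$ the largest integer contained in the tableaux $b_1,\ldots,b_L$. If $r\geq N$ and $s\geq\max_i\{s_i\}$, then $$\bar{E}(p)=C-\tau^{r,s}(p),\qquad C=\sum_{1\le i<j\le L}\min(r_i,r_j)\cdot\min(s_i,s_j).$$
   Context: $B^{r,s}$ denotes the set of semistandard Young tableaux (rows weakly increasing, columns strictly increasing) of rectangular shape $(s^r)$ ($r$ rows, $s$ columns) over the alphabet $\{1,\ldots,n+1\}$, where $n$ is a fixed integer with all occurring values of $r$ in $\{1,\ldots,n\}$ (these are type $A_n^{(1)}$ Kirillov--Reshetikhin crystals); $B\otimes B'$ is, as a set, the Cartesian product. A path is an element of such a tensor product. For a tableau $Y$ with rows $y_1,\ldots,y_r$ from top to bottom, $row(Y)=y_r y_{r-1}\cdots y_1$. For a tableau $Y$ and a word $w=w_1w_2\cdots$, $(Y\leftarrow w)$ is the tableau obtained by successive Schensted row insertion of $w_1,w_2,\ldots$ into $Y$. The combinatorial $R$ is the crystal isomorphism $B^{r,s}\otimes B^{r',s'}\to B^{r',s'}\otimes B^{r,s}$, written $b\otimes b'\simeq\tilde b'\otimes\tilde b$; it is characterized by $(b'\leftarrow row(b))=(\tilde b\leftarrow row(\tilde b'))$. The energy function $H(b\otimes b')$ for $b\otimes b'\in B^{r,s}\otimes B^{r',s'}$ is the number of nodes of $(b'\leftarrow row(b))$ lying outside the concatenation of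 the partitions $(s^r)$ and $(s'^{r'})$, where the concatenation of partitions $x,y$ is $(x_1+y_1,x_2+y_2,\ldots)$. Put $\bar H(b\otimes b')=\min(r,r')\min(s,s')-H(b\otimes b')$. For a path $b_1\otimes\cdots\otimes b_L$ and $i<j$ define $b_j^{(i)}\in B^{r_j,s_j}$ by moving $b_j$ to the left using the combinatorial $R$: $b_j^{(j)}=b_j$ and, for $k=j-1,j-2,\ldots,i$, $b_k\otimes b_j^{(k+1)}\simeq b_j^{(k)}\otimes b_k'$. Then $$\bar E(p)=\sum_{i<j}\bar H(b_i\otimes b_j^{(i+1)}),\qquad \mathrm{maj}(p)=\sum_{i<j}H(b_i\otimes b_j^{(i+1)}),$$ and $\tau^{r,s}(p)=\mathrm{maj}(u^{r,s}\otimes p)$, where $u^{r,s}\in B^{r,s}$ is the highest element, i.e. the tableau whose $i$-th row consists of $s$ letters $i$ for $1\le i\le r$. *)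

(* Defs.v *)
From HB Require Import structures.
From mathcomp Require Import all_boot all_order all_algebra.
Import GRing.Theory.

Set Implicit Arguments.
Unset Strict Implicit.
Unset Printing Implicit Defensive.

(* Letter k of the alphabet {1, ..., n+1} is encoded by the ordinal of value
   k - 1; [letter] below gives back the letter itself. *)
Definition semistandard n r s (t : 'M['I_n.+1]_(r, s)) : bool :=
  [forall i, forall j1 : 'I_s, forall j2 : 'I_s,
     (j1 <= j2) ==> (t i j1 <= t i j2)]
  && [forall j, forall i1 : 'I_r, forall i2 : 'I_r,
     (i1 < i2) ==> (t i1 j < t i2 j)].

(* The set B^{r,s} for type A_n^(1). *)
Record KR n r s := MkKR {
  KRmx :> 'M['I_n.+1]_(r, s);
  KR_semistandard : semistandard KRmx }.

HB.instance Definition _ n r s := [isSub for @KRmx n r s].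
HB.instance Definition _ n r s := [Equality of KR n r s by <:].
HB.instance Definition _ n r s := [Choice of KR n r s by <:].
HB.instance Definition _ n r s := [Countable of KR n r s by <:].
HB.instance Definition _ n r s := [Finite of KR n r s by <:].

Definition letter n r s (b : KR n r s) (i : 'I_r) (j : 'I_s) : nat :=
  (b i j).+1.

(* Arbitrary tableaux are lists of nonempty rows, from top to bottom; the
   filter only matters when s = 0, where B^{r,0} contains the empty tableau. *)
Definition tableau := seq (seq nat).

Definition rows n r s (b : KR n r s) : tableau :=
  [seq y <- [seq [seq letter b i j | j <- enum 'I_s] | i <- enum 'I_r]
     | y != [::]].

Definition row_word n r s (b : KR n r s) : seq nat := flatten (rev (rows b)).

(* Schensted row insertion: x bumps the leftmost entry strictly larger than x
   into the next row, or is appended if there is none. *)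
Fixpoint insert (Y : tableau) (x : nat) : tableau :=
  if Y is y :: Y' then
    let k := find (fun z => x < z) y in
    if k < size y then set_nth 0 y k x :: insert Y' (nth 0 y k)
    else rcons y x :: Y'
  else [:: [:: x]].

Definition insert_word (Y : tableau) (w : seq nat) : tableau :=
  foldl insert Y w.

(* (b' <- row(b)) for b (x) b'. *)
Definition product_tableau n r s r' s' (b : KR n r s) (b' : KR n r' s') :
  tableau := insert_word (rows b') (row_word b).

(* b (x) b' is sent to c.1 (x) c.2, the unique pair having the same product
   tableau.  Such a pair always exists, so the default (b', b) is never used. *)
Definition combR n r s r' s' (b : KR n r s) (b' : KR n r' s') :
  KR n r' s' * KR n r s :=
  odflt (b', b)
    [pick c : KR n r' s' * KR n r s |
       product_tableau b b' == product_tableau c.1 c.2].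

(* Row k (from 0) of the concatenation of (s^r) and (s'^r') has length
   (k < r) * s + (k < r') * s'; the truncated difference counts the nodes of
   row k lying outside it. *)
Definition energyH n r s r' s' (b : KR n r s) (b' : KR n r' s') : nat :=
  let T := product_tableau b b' in
  \sum_(k < size T) (size (nth [::] T k) - ((k < r) * s + (k < r') * s')).

Definition energyHbar n r s r' s' (b : KR n r s) (b' : KR n r' s') : int :=
  ((minn r r' * minn s s')%:Z - (energyH b b')%:Z)%R.

Record factor n := Factor {
  height : nat;
  width : nat;
  tab : KR n height width }.

(* A path b_1 (x) ... (x) b_L, indexed from 0. *)
Definition KRpath n L := L.-tuple (factor n).

Definition move_left n (a c : factor n) : factor n :=
  Factor (combR (tab a) (tab c)).1.

(* b_j^(i): b_j moved to the left past b_{j-1}, ..., b_i in this order. *)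
Definition moved n L (p : KRpath n L) (i : nat) (j : 'I_L) : factor n :=
  foldr (fun k c => move_left (tnth p k) c) (tnth p j)
    [seq k : 'I_L <- enum 'I_L | i <= k < j].

Definition Ebar n L (p : KRpath n L) : int :=
  (\sum_(i < L) \sum_(j < L | (i < j)%N)
     energyHbar (tab (tnth p i)) (tab (moved p i.+1 j)))%R.

Definition maj n L (p : KRpath n L) : nat :=
  \sum_(i < L) \sum_(j < L | i < j)
     energyH (tab (tnth p i)) (tab (moved p i.+1 j)).

Section Highest.
Variables (n r s : nat) (hr : 0 < r <= n).

Definition highest_mx : 'M['I_n.+1]_(r, s) := \matrix_(i, j) inord i.

Lemma highest_semistandard : semistandard highest_mx.
Proof.
have lt_n (i : 'I_r) : i < n.+1.
  by case/andP: hr => _ le_rn; apply: leq_trans (ltn_ord i) (leqW le_rn).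
apply/andP; split; apply/forallP => i; apply/forallP => j; apply/forallP => k;
  by apply/implyP; rewrite !mxE ?inordK.
Qed.

(* u^{r,s} *)
Definition highest : KR n r s := MkKR highest_semistandard.
End Highest.

Definition tau n r s (hr : 0 < r <= n) L (p : KRpath n L) : nat :=
  maj [tuple of Factor (highest s hr) :: p].

(* The largest integer occurring in a path (0 if there is none). *)
Definition max_letter n L (p : KRpath n L) : nat :=
  \max_(k < L) \max_(i < height (tnth p k)) \max_(j < width (tnth p k))
    letter (tab (tnth p k)) i j.

(* Main.v *)
Require Import Defs.
From mathcomp Require Import all_boot all_order all_algebra.

(** Heights and widths travel with a tableau when it is moved to the left, so
    the definition of the barred energy gives [Ebar p = C - maj p] for every
    path [p] ([Ebar_maj]).  Prepending [u] to [p] adds to [maj p] exactly the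
    energies of [u] against the tableaux [b_j] moved to the first place
    ([tau_maj]), so everything reduces to showing that these energies vanish.

    The combinatorial R permutes letters ([perm_combR]), so a tableau moved to
    the first place still has all its letters at most [r].  Now insert
    [row(u) = r^s (r-1)^s ... 1^s] into a tableau [c] whose letters are at most
    [r].  In the first row, the letters [r] are appended at the end; the [s]
    letters [r-1] then bump [s] letters [r], the [s] letters [r-2] bump [s]
    letters [r-1], and so on.  Altogether the first row gains [s] letters and
    the second row receives [r^s (r-1)^s ... 2^s], to which the same analysis
    applies ([insert_staircase_row]).  Each of the first [r] rows of [c] thus
    grows by [s] cells and the other rows do not change: the shape is the
    concatenation of the two rectangles, and the energy is 0
    ([energyH_highest]). *)

Set Implicit Arguments.
Unset Strict Implicit.
Unset Printing Implicit Defensive.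

Import GRing.Theory.

(** * Insertion permutes letters *)

Lemma perm_insert Y x : perm_eq (flatten (insert Y x)) (x :: flatten Y).
Proof.
elim: Y x => [|y Y IHY] x //=.
set k := find _ y; case: ifP => [lt_ky | _] /=; last first.
  by rewrite cat_rcons -cat1s perm_catCA.
rewrite set_nthE lt_ky -{4}(cat_take_drop k y) (drop_nth 0 lt_ky).
rewrite -!catA /= -[x :: take k y ++ _]cat1s perm_sym perm_catCA perm_cat2l.
by rewrite /= perm_cons -cat1s perm_catCA perm_cat2l perm_sym IHY.
Qed.

Lemma perm_insert_word Y w :
  perm_eq (flatten (insert_word Y w)) (flatten Y ++ w).
Proof.
elim: w Y => [|x w IHw] Y /=; first by rewrite cats0.
apply: perm_trans (IHw _) _; rewrite -cat1s catA perm_cat2r.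
by apply: perm_trans (perm_insert _ _) _; rewrite perm_sym perm_catC.
Qed.

Lemma perm_product_tableau n r s r' s' (b : KR n r s) (b' : KR n r' s') :
  perm_eq (flatten (product_tableau b b'))
          (flatten (rows b') ++ flatten (rows b)).
Proof.
apply: perm_trans (perm_insert_word _ _) _; rewrite perm_cat2l.
by apply: perm_flatten; rewrite perm_rev.
Qed.

Lemma product_combR n r s r' s' (b : KR n r s) (b' : KR n r' s') :
  flatten (product_tableau b b') =
    flatten (product_tableau (combR b b').1 (combR b b').2)
  \/ combR b b' = (b', b).
Proof. by rewrite /combR; case: pickP => [c /eqP-> | _] /=; [left|right]. Qed.

(** Both outcomes of the search defining the combinatorial R keep the letters:
    a pair that is found has the same product tableau, hence the same letters,
    and the default pair is made of the same two tableaux. *)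
Lemma perm_combR n r s r' s' (b : KR n r s) (b' : KR n r' s') :
  perm_eq (flatten (rows b') ++ flatten (rows b))
          (flatten (rows (combR b b').1) ++ flatten (rows (combR b b').2)).
Proof.
have [eq_prod | -> //] := product_combR b b'.
have := perm_product_tableau b b'; rewrite perm_sym eq_prod => /perm_trans.
by apply; apply: perm_trans (perm_product_tableau _ _) _; rewrite perm_catC.
Qed.

(** * Inserting the highest element *)

(** The word [(m+d-1)^s ... (m+1)^s m^s]; for [m = 1] and [d = r] this is
    [row(u^{r,s})].  Varying [m] covers the words bumped out of a row. *)
Definition staircase s m d : seq nat :=
  flatten (rev [seq nseq s k | k <- iota m d]).

Lemma staircaseS s m d : staircase s m d.+1 = staircase s m.+1 d ++ nseq s m.
Proof. by rewrite /staircase /= rev_cons flatten_rcons. Qed.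

Lemma insert_word_cat Y v w :
  insert_word Y (v ++ w) = insert_word (insert_word Y v) w.
Proof. exact: foldl_cat. Qed.

Lemma insert_word_max Y y m s : all (leq^~ m) y ->
  insert_word (y :: Y) (nseq s m) = (y ++ nseq s m) :: Y.
Proof.
elim: s y => [|s IHs] y le_ym /=; first by rewrite cats0.
have /hasNfind-> : ~~ has (fun z => m < z) y.
  by rewrite -all_predC; apply: sub_all le_ym => z /=; rewrite -leqNgt.
by rewrite ltnn IHs ?all_rcons ?leqnn // cat_rcons.
Qed.

(** The entry first exceeding [m] is always the first [m+1] left in the block,
    so the block is bumped entry by entry, in order, whatever follows it. *)
Lemma insert_word_bump Y P Q m s : all (leq^~ m) P ->
  insert_word ((P ++ nseq s m.+1 ++ Q) :: Y) (nseq s m)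
  = (P ++ nseq s m ++ Q) :: insert_word Y (nseq s m.+1).
Proof.
elim: s P Y => [|s IHs] P Y le_Pm //=.
have noP : ~~ has (fun z => m < z) P.
  by rewrite -all_predC; apply: sub_all le_Pm => z /=; rewrite -leqNgt.
rewrite find_cat (negPf noP) /= ltnSn addn0.
rewrite size_cat /= -{1}[size P]addn0 ltn_add2l /=.
rewrite nth_cat ltnn subnn /= set_nthE size_cat /= -{1}[size P]addn0 ltn_add2l.
rewrite /= take_size_cat // drop_cat ltnNge leqnSn /= subSnn /= drop0.
rewrite -cat_rcons IHs ?all_rcons ?leqnn //.
by rewrite cat_rcons.
Qed.

Lemma sorted_split_max P m : sorted leq P -> all (leq^~ m.+1) P ->
  exists P' a,
    [/\ P = P' ++ nseq a m.+1, sorted leq P' & all (leq^~ m) P'].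
Proof.
elim/last_ind: P => [|P x IHP] sP; first by exists [::], 0.
rewrite all_rcons => /andP[le_x leP].
have sP' : sorted leq P by move: sP; rewrite -cats1 => /cat_sorted2[].
have [eq_x | ne_x] := eqVneq x m.+1.
  have [P' [a [-> sP'' leP'']]] := IHP sP' leP.
  exists P', a.+1; split=> //.
  by rewrite eq_x rcons_cat; congr (_ ++ _); elim: a => //= a ->.
exists (rcons P x), 0; split; rewrite ?cats0 //.
have le_xm : x <= m by rewrite -ltnS ltn_neqAle ne_x.
rewrite all_rcons le_xm; apply/allP => z Pz /=.
move: sP; rewrite -cats1 (sorted_pairwise leq_trans) pairwise_cat.
by case/andP=> /allrelP/(_ z x Pz); rewrite inE => /(_ (eqxx x)) /leq_trans->.
Qed.

(** Inserting the [s] copies of a letter leaves them as a block in the row, and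
    this block is exactly what the [s] copies of the next letter bump.  The
    prefix [P] is what makes the induction work: the copies of [m] present
    in [y] at the end of [P] commute with the block [m^s], so that the block
    which the next letters [m-1] bump starts right after the letters at most
    [m-1]. *)
Lemma insert_staircase_row s d m y Y : sorted leq y -> all (gtn (m + d.+1)) y ->
  exists P Q,
    [/\ sorted leq P, all (leq^~ m) P, size P + size Q = size y
      & insert_word (y :: Y) (staircase s m d.+1)
        = (P ++ nseq s m ++ Q) :: insert_word Y (staircase s m.+1 d)].
Proof.
elim: d m => [|d IHd] m sy lt_y.
  have le_y : all (leq^~ m) y.
    by apply: sub_all lt_y => z /=; rewrite addn1 ltnS.
  exists y, [::]; split; rewrite ?addn0 //.
  by rewrite staircaseS insert_word_max // cats0.
have lt_y' : all (gtn (m.+1 + d.+1)) y by rewrite addSnnS.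
have [P [Q [sP leP szPQ eq_ins]]] := IHd m.+1 sy lt_y'.
have [P' [a [def_P sP' leP']]] := sorted_split_max sP leP.
exists P', (nseq a m.+1 ++ Q); split=> //.
  by rewrite -szPQ def_P !size_cat addnA.
rewrite staircaseS insert_word_cat eq_ins def_P.
have -> : (P' ++ nseq a m.+1) ++ nseq s m.+1 ++ Q
          = P' ++ nseq s m.+1 ++ (nseq a m.+1 ++ Q).
  by rewrite -!catA; congr (_ ++ _); rewrite !catA -!nseqD addnC.
by rewrite insert_word_bump // -insert_word_cat -staircaseS.
Qed.

Lemma size_insert_staircase s m d Y k :
    all (sorted leq) Y -> all (all (gtn (m + d))) Y ->
  size (nth [::] (insert_word Y (staircase s m d)) k)
  = size (nth [::] Y k) + (k < d) * s.
Proof.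
elim: d m Y k => [|d IHd] m Y k sY ltY; first by rewrite addn0.
(* The word is nonempty for s > 0, so an empty tableau may be given an empty
   first row beforehand without changing the result of the insertion. *)
wlog [y [Y' defY]] : Y sY ltY / exists y Y', Y = y :: Y'.
  move=> IH; case: Y sY ltY => [|y Y'] sY ltY; last first.
    by apply: IH => //; exists y, Y'.
  have [-> | s_gt0] := posnP s.
    have staircase0 e l : staircase 0 l e = [::].
      by elim: e l => // e IHe l; rewrite staircaseS IHe.
    by rewrite staircase0 muln0 addn0.
  have := IH [:: [::]] isT isT (ex_intro _ _ (ex_intro _ _ erefl)).
  have -> : insert_word [:: [::]] (staircase s m d.+1)
            = insert_word [::] (staircase s m d.+1).
    have : size (staircase s m d.+1) != 0.
      rewrite staircaseS size_cat size_nseq.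
      by rewrite addn_eq0 negb_and -!lt0n s_gt0 orbT.
    by case: (staircase _ _ _).
  by move=> ->; case: k {IH} => [|[|k]].
rewrite {Y}defY /= in sY ltY *.
case/andP: sY => sy sY; case/andP: ltY => lty ltY.
have [P [Q [_ _ szPQ ->]]] := insert_staircase_row s Y' sy lty.
case: k => [|k] /=.
  by rewrite !size_cat size_nseq mul1n -szPQ addnCA addnC.
by rewrite IHd // addSnnS.
Qed.

Lemma row_word_highest n r s (hr : 0 < r <= n) :
  row_word (highest s hr) = staircase s 1 r.
Proof.
have flatten_nonempty (T : eqType) (ss : seq (seq T)) :
    flatten [seq y <- ss | y != [::]] = flatten ss.
  by elim: ss => //= -[|x y] ss IHss //=; rewrite IHss.
rewrite /row_word /rows -filter_rev flatten_nonempty /staircase.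
congr (flatten (rev _)).
have -> : iota 1 r = [seq (val i).+1 | i <- enum 'I_r].
  by rewrite (map_comp succn) val_enum_ord -[1]addn0 iotaDl.
rewrite -map_comp; apply: eq_map => i /=.
have letterE j : letter (highest s hr) i j = i.+1.
  rewrite /letter mxE inordK //.
  by case/andP: hr => _ le_rn; apply: leq_trans (ltn_ord i) (leqW le_rn).
rewrite (eq_map letterE) -[s in RHS](size_enum_ord s).
by elim: (enum _) => //= _ e ->.
Qed.

(** * Rows of a rectangular tableau *)

Lemma rows_sorted n r s (b : KR n r s) : all (sorted leq) (rows b).
Proof.
apply/allP => y; rewrite mem_filter => /andP[_ /mapP[i _ ->]].
rewrite sorted_map.
have : sorted (fun j1 j2 : 'I_s => j1 <= j2) (enum 'I_s).
  by have := iota_sorted 0 s; rewrite -val_enum_ord sorted_map.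
apply: sub_sorted => j1 j2 le_j /=; rewrite /letter ltnS.
have /andP[/forallP/(_ i)/forallP/(_ j1)/forallP/(_ j2)/implyP le_b _] :=
  KR_semistandard b.
exact: le_b.
Qed.

Lemma size_row_le n r s (b : KR n r s) k :
  size (nth [::] (rows b) k) <= (k < r) * s.
Proof.
have [lt_k | ge_k] := ltnP k (size (rows b)); last by rewrite nth_default.
have -> : k < r.
  apply: leq_trans lt_k _; rewrite size_filter (leq_trans (count_size _ _)) //.
  by rewrite size_map size_enum_ord.
move: (mem_nth [::] lt_k); rewrite mem_filter => /andP[_ /mapP[i _ ->]].
by rewrite size_map size_enum_ord mul1n.
Qed.

Lemma energyH_highest n r s (hr : 0 < r <= n) r' s' (c : KR n r' s') :
  all (leq^~ r) (flatten (rows c)) -> energyH (highest s hr) c = 0.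
Proof.
move=> le_c; apply: big1 => k _; move: (nat_of_ord k) => {}k.
apply/eqP; rewrite subn_eq0.
rewrite /product_tableau row_word_highest size_insert_staircase ?rows_sorted //.
  by rewrite addnC leq_add2l size_row_le.
apply/allP => y cy; apply/allP => z yz; rewrite /= add1n ltnS.
by apply: (allP le_c); apply/flattenP; exists y.
Qed.

(** * Moving tableaux along a path *)

Lemma height_moved n L (p : KRpath n L) i j :
  height (moved p i j) = height (tnth p j).
Proof. by rewrite /moved; elim: [seq _ <- _ | _]. Qed.

Lemma width_moved n L (p : KRpath n L) i j :
  width (moved p i j) = width (tnth p j).
Proof. by rewrite /moved; elim: [seq _ <- _ | _]. Qed.

Lemma Ebar_maj n L (p : KRpath n L) :
  Ebar p = ((\sum_(i < L) \sum_(j < L | i < j)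
               minn (height (tnth p i)) (height (tnth p j))
               * minn (width (tnth p i)) (width (tnth p j)))%:Z
            - (maj p)%:Z)%R.
Proof.
rewrite /Ebar /maj -!natz !natr_sum -sumrB; apply: eq_bigr => i _.
rewrite !natr_sum -sumrB; apply: eq_bigr => j _.
by rewrite !natz -(height_moved p i.+1 j) -(width_moved p i.+1 j).
Qed.

Lemma moved_cons n L (f : factor n) (p : KRpath n L) i (j : 'I_L) :
  moved [tuple of f :: p] i.+1 (lift ord0 j) = moved p i j.
Proof.
rewrite /moved enum_ordSl /= filter_map foldr_map.
by rewrite tnthS; elim: [seq _ <- _ | _] => //= k e ->; rewrite tnthS.
Qed.

Lemma tau_maj n r s (hr : 0 < r <= n) L (p : KRpath n L) :
  tau s hr p
  = \sum_(j < L) energyH (highest s hr) (tab (moved p 0 j)) + maj p.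
Proof.
rewrite /tau /maj big_ord_recl; congr (_ + _).
  rewrite big_mkcond big_ord_recl /= add0n.
  by apply: eq_bigr => j _; rewrite moved_cons.
apply: eq_bigr => i _; rewrite big_mkcond big_ord_recl /= add0n [RHS]big_mkcond.
by apply: eq_bigr => j _; rewrite moved_cons tnthS.
Qed.

Lemma move_left_all n (a c : factor n) (P : pred nat) :
    all P (flatten (rows (tab a))) -> all P (flatten (rows (tab c))) ->
  all P (flatten (rows (tab (move_left a c)))).
Proof.
move=> Pa Pc; have := perm_all P (perm_combR (tab a) (tab c)).
by rewrite !all_cat Pa Pc => /esym/andP[].
Qed.

Lemma moved_all n L (p : KRpath n L) (P : pred nat) i (j : 'I_L) :
    (forall k, all P (flatten (rows (tab (tnth p k))))) ->
  all P (flatten (rows (tab (moved p i j)))).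
Proof.
move=> Pp; rewrite /moved.
by elim: [seq _ <- _ | _] => //= k e IHe; apply: move_left_all.
Qed.

Lemma letters_le_max n L (p : KRpath n L) k :
  all (leq^~ (max_letter p)) (flatten (rows (tab (tnth p k)))).
Proof.
apply/allP => x /flattenP[y]; rewrite mem_filter => /andP[_ /mapP[i _ ->]].
case/mapP=> j _ ->; rewrite /max_letter.
apply: leq_trans (leq_bigmax k).
apply: leq_trans (leq_bigmax i).
exact: (leq_bigmax j).
Qed.

Lemma tau_eq_maj n r s (hr : 0 < r <= n) L (p : KRpath n L) :
  max_letter p <= r -> tau s hr p = maj p.
Proof.
move=> le_Nr; rewrite tau_maj big1 // => j _; apply: energyH_highest.
apply: moved_all => k; apply: sub_all (letters_le_max p k) => x /= le_xN.
exact: leq_trans le_xN le_Nr.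
Qed.

Theorem theorem6p3 (n L : nat) (r_ s_ : 'I_L -> nat)
    (hr_ : forall i, 0 < r_ i <= n)
    (b : forall i : 'I_L, KR n (r_ i) (s_ i))
    (r s : nat) (hr : 0 < r <= n) :
  let p : KRpath n L := [tuple Factor (b i) | i < L] in
  let N := max_letter p in
  let C := \sum_(i < L) \sum_(j < L | i < j)
             minn (r_ i) (r_ j) * minn (s_ i) (s_ j) in
  N <= r ->
  \max_(i < L) s_ i <= s ->
  Ebar p = (C%:Z - (tau s hr p)%:Z)%R.
Proof.
move=> p N C le_Nr _; rewrite Ebar_maj (tau_eq_maj s hr le_Nr).
congr (Posz _ - _)%R; apply: eq_bigr => i _; apply: eq_bigr => j _.
by rewrite !tnth_mktuple.
Qed.
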